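(* Let $n\ge 2$ and $r\ge 1$ be integers, and let $\dot x = f(x)$, $x\in\mathbb{R}^n$, be a (weakly) contractive ODE with $f$ of class $C^{r+1}$. Then $f$ is a finite sum of vector fields on $\mathbb{R}^n$, each of which is of class $C^r$, two-dimensional, and (weakly) contractive.
   Context: An ODE $\dot x = f(x)$ on $\mathbb{R}^n$ (or its vector field $f$) is called (weakly) contractive if $\operatorname{tr}\,df(x)\le 0$ for all $x$, where $df$ is the Jacobian matrix of $f$ (so $\operatorname{tr}\,df$ is the divergence of $f$). An ODE on $\mathbb{R}^n$ (or its vector field) is called two-dimensional if there are two indices $i\neq j$ such that $\dot x_k=0$ for all $k\ne i,j$, i.e. all components of the vector field other than the $i$th and $j$th vanish identically (the $i$th and $j$th components may depend on all of $x_1,\dots,x_n$). *)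

(* Defs.v *)
From mathcomp Require Import all_boot all_order all_algebra.
From mathcomp Require Import all_classical all_reals all_analysis.

Set Implicit Arguments.
Unset Strict Implicit.
Unset Printing Implicit Defensive.

Import GRing.Theory Num.Theory.
Import numFieldNormedType.Exports.

Local Open Scope classical_set_scope.
Local Open Scope ring_scope.

(* Points and vectors of R^n are row vectors, as in the definition of ['J]. *)

(* Class C^k on R^n: all iterated partial derivatives of order at most k exist
   and are continuous. The clause [derivable] is needed because ['D_v f] is a
   total operator. *)
Fixpoint class_C (R : realType) (n m : nat) (k : nat)
    (f : 'rV[R]_n -> 'rV[R]_m) : Prop :=
  continuous f /\
  match k with
  | 0 => True
  | k'.+1 => forall i : 'I_n,
      (forall x, derivable f x (delta_mx 0 i)) /\
      class_C k' ('D_(delta_mx 0 i) f)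
  end.

(* ['J f x] acts on row vectors from the right, so it is the transpose of the
   usual Jacobian matrix; the trace is the same. It is meaningful only where f
   is differentiable, in particular for f of class C^1. *)
Definition contractive (R : realType) (n : nat)
    (f : 'rV[R]_n -> 'rV[R]_n) : Prop :=
  forall x, \tr ('J f x) <= 0.

Definition two_dimensional (R : realType) (n : nat)
    (f : 'rV[R]_n -> 'rV[R]_n) : Prop :=
  exists i j : 'I_n, i != j /\
    forall k : 'I_n, k != i -> k != j -> forall x, f x 0 k = 0.

(* Main.v *)
(* Fix a coordinate [l] and let [H_i] be the primitive in the variable [x_l],
   vanishing on [x_l = 0], of [D_i f_i].  Each field [f_i e_i - H_i e_l] is
   divergence free, and what remains of [f] is [(sum_i H_i) e_l], whose
   divergence is that of [f].  Since [D_i f_i] is only of class C^r, so is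
   [H_i]: this is the loss of one derivative. *)

From HB Require Import structures.
Require Import Defs.
From mathcomp Require Import all_boot all_order all_algebra.
From mathcomp Require Import all_classical all_reals all_analysis.

Set Implicit Arguments.
Unset Strict Implicit.
Unset Printing Implicit Defensive.

Import Order.TTheory GRing.Theory Num.Theory.
Import numFieldNormedType.Exports.

Local Open Scope classical_set_scope.
Local Open Scope ring_scope.

(** * Directional derivatives along lines, and the mean value theorem *)

Section directional.
Context {R : realType} {V U : normedModType R}.

(** The hypothesis makes the two difference quotients equal as functions of [h], so existence and
    value of the derivative transfer both ways, even where [f] has only this one directional
    derivative. It serves for lines and for linear changes of variable. *)
Lemma is_derive_affine (W : normedModType R) (f : U -> W) (L : V -> U)
    (x v : V) (w : U) (d : W) :
  (forall h : R, L (h *: v + x) = h *: w + L x) ->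
  is_derive x v (f \o L) d <-> is_derive (L x) w f d.
Proof.
move=> Lh.
have E :
    (fun h => h^-1 *: (((f \o L) \o shift x) (h *: v) - (f \o L) x)) =
    (fun h => h^-1 *: ((f \o shift (L x)) (h *: w) - f (L x))).
  by apply/funext => h /=; rewrite Lh.
split=> -[dv <-]; split.
- by move: dv; rewrite /derivable E.
- by rewrite /derive E.
- by move: dv; rewrite /derivable -E.
- by rewrite /derive -E.
Qed.

End directional.

Section directional_real.
Context {R : realType} {V : normedModType R}.

Lemma is_derive_line (f : V -> R) (x v : V) (t d : R) :
  is_derive (t *: v + x) v f d ->
  is_derive t 1 (fun h : R => f (h *: v + x)) d.
Proof.
move=> fd; apply: (iffRL (@is_derive_affine R R V R f
  (fun s : R => s *: v + x) t 1 v d _) fd) => h.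
by rewrite scalerDl addrA [h *: 1]mulr1.
Qed.

(** Restricting [f] to the line through [x] reduces this to the one-variable chain rule with inner
    function [h |-> c * h], which also covers [c = 0]. *)
Lemma is_derive_scale (f : V -> R) (x v : V) (c d : R) :
  is_derive x v f d -> is_derive x (c *: v) f (c * d).
Proof.
move=> fd.
have /is_derive_line fd' : is_derive (0 *: v + x) v f d.
  by rewrite scale0r add0r.
have H : is_derive (0 : R) 1 (fun h : R => c * h) c.
  have := @is_deriveM R R (cst c) id 0 1 0 1 _ _.
  rewrite /= scaler0 addr0 => H; apply: is_derive_eq (H _ _) _.
  by rewrite [_ *: _]mulr1.
have H2 : is_derive (0 : R) 1 (fun h : R => f (h *: (c *: v) + x)) (c * d).
  have := @is_derive1_comp R (fun h : R => f (h *: v + x))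
    (fun h : R => c * h) 0 d c.
  rewrite mulr0 => /(_ fd' H); rewrite mulrC.
  congr (is_derive _ _ _ _).
  by apply/funext => h /=; rewrite scalerA mulrC.
have := iffLR (@is_derive_affine R R V R f
  (fun s : R => s *: (c *: v) + x) 0 1 (c *: v) (c * d) _) H2.
rewrite /= scale0r add0r; apply => h.
by rewrite /= !addr0 [h *: 1]mulr1.
Qed.

(* Working with the direction [t *: v] on [[0, 1]] avoids a case split on the
   sign of [t]. *)
Lemma MVT_line (f : V -> R) (x v : V) (t : R) :
  (forall y, derivable f y v) ->
  exists2 c : R, 0 <= c <= 1 &
    f (t *: v + x) - f x = t * 'D_v f ((c * t) *: v + x).
Proof.
move=> df.
have dg (s : R) : is_derive s 1 (fun h : R => f (h *: (t *: v) + x))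
    (t * 'D_v f (s *: (t *: v) + x)).
  exact/is_derive_line/is_derive_scale/derivableP/df.
have [|c c01 E] := @MVT_segment R (fun h : R => f (h *: (t *: v) + x))
  (fun s => t * 'D_v f (s *: (t *: v) + x)) 0 1 ler01.
  by apply: derivable_within_continuous => s _; have [] := dg s.
exists c; first by move: c01; rewrite in_itv.
by move: E; rewrite scale1r scale0r add0r subr0 mulr1 scalerA.
Qed.

End directional_real.

(** * Integrals over the unit interval depending on a parameter *)

Section parametric_integral.
Context {R : realType} {V : normedModType R}.
Notation mu := (@lebesgue_measure R).
Implicit Types F : R -> V -> R.

(** With a fixed interval the parameter enters only through the integrand. Primitives along a
    coordinate are brought to this form by rescaling, whatever the sign of their upper bound. *)
Definition int01 (g : R -> R) : R := \int[mu]_(s in `[0%R, 1%R]) g s.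

Lemma continuous_integrable01 (g : R -> R) :
  continuous g -> mu.-integrable `[0%R, 1%R] (EFin \o g).
Proof.
move=> gc; apply: continuous_compact_integrable; first exact: segment_compact.
exact: continuous_subspaceT.
Qed.

Lemma continuous_section1 F : continuous (fun p : R * V => F p.1 p.2) ->
  forall x, continuous (F^~ x).
Proof.
move=> Fc x s.
by apply: (@continuous2_cvg _ _ _ _ _ _ id (cst x) F s x);
  [exact: (Fc (s, x))|exact: cvg_id|exact: cvg_cst].
Qed.

Lemma int01_le (g : R -> R) (e : R) : continuous g ->
  (forall s, `[0, 1]%classic s -> `|g s| <= e) -> `|int01 g| <= e.
Proof.
move=> gc ge.
have ig := continuous_integrable01 gc.
apply: le_trans (le_normr_Rintegral _ ig) _ => //.
have ie : mu.-integrable `[0%R, 1%R] (EFin \o cst e).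
  by apply: continuous_integrable01; exact: cst_continuous.
apply: (@le_trans _ _ (\int[mu]_(s in `[0%R, 1%R]) (cst e s))).
  apply: le_Rintegral => //.
  by apply: continuous_integrable01 => s; apply: cvg_norm; exact: gc.
rewrite Rintegral_cst//= lebesgue_measure_itv/= lte01 /=.
by rewrite oppr0 addr0 mulr1.
Qed.

Lemma int01B (g h : R -> R) : continuous g -> continuous h ->
  int01 g - int01 h = int01 (fun s => g s - h s).
Proof.
by move=> gc hc; rewrite /int01 RintegralB//; exact: continuous_integrable01.
Qed.

Lemma int01D (g h : R -> R) : continuous g -> continuous h ->
  int01 g + int01 h = int01 (fun s => g s + h s).
Proof.
by move=> gc hc; rewrite /int01 RintegralD//; exact: continuous_integrable01.
Qed.

Lemma int01Z (g : R -> R) c : continuous g ->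
  c * int01 g = int01 (fun s => c * g s).
Proof.
by move=> gc; rewrite /int01 RintegralZl//; exact: continuous_integrable01.
Qed.

Lemma int01_continuous F : continuous (fun p : R * V => F p.1 p.2) ->
  continuous (fun x => int01 (F^~ x)).
Proof.
move=> Fc x; apply/cvgrPdist_le => e e0.
have : \forall y \near x, `[0, 1]%classic `<=` (fun s : R => `|F s x - F s y| <= e).
  (* Compactness of [[0, 1]] turns the local estimates around each [(s, x)] into one neighbourhood
     of [x] that serves all [s]. *)
  apply: (iffLR (compact_near_coveringP _) (@segment_compact R 0 1) _
    (nbhs x) (fun y s => `|F s x - F s y| <= e)) => s _.
  have e20 : 0 < e / 2 by rewrite divr_gt0.
  have /cvgrPdist_le /(_ _ e20) [[A B] /= [As Bx] AB] := Fc (s, x).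
  exists (A, B) => //= -[t y] /= [At By].
  have H1 := AB (t, y) (conj At By).
  have H2 := AB (t, x) (conj At (nbhs_singleton Bx)).
  rewrite /= in H1 H2.
  rewrite (splitr e) -(subrKA (F s x)); apply: le_trans (ler_normD _ _) _.
  by rewrite lerD// distrC.
apply: filterS => y Hy.
rewrite int01B; try exact: continuous_section1.
apply: int01_le => // s; apply: continuousB; exact: continuous_section1.
Qed.

(** On the line [h *: v + x] this becomes differentiation under the integral sign in the real
    variable [h]. The dominating function is a constant, since [F'] is bounded along the compact set
    [-1 <= h <= 1], [0 <= s <= 1]. *)
Lemma is_derive_int01 F (F' : R -> V -> R) (x v : V) :
  continuous (fun p : R * V => F p.1 p.2) ->
  continuous (fun p : R * V => F' p.1 p.2) ->
  (forall s y, is_derive y v (F s) (F' s y)) ->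
  is_derive x v (fun y => int01 (F^~ y)) (int01 (F'^~ x)).
Proof.
move=> Fc F'c FF'.
pose f (h s : R) := F s (h *: v + x).
have df (h s : R) : is_derive h 1 (f ^~ s) (F' s (h *: v + x)).
  exact: (is_derive_line (FF' s (h *: v + x))).
have lc : continuous (fun h : R => h *: v + x).
  by move=> h; apply: cvgD; [exact: scalel_continuous|exact: cvg_cst].
have F'lc : continuous (fun p : R * R => F' p.2 (p.1 *: v + x)).
  move=> p; apply: (@continuous2_cvg _ _ _ _ _ _ snd (fun p : R * R => p.1 *: v + x) F').
  - exact: (F'c (p.2, p.1 *: v + x)).
  - exact: cvg_snd.
  - by apply: (@continuous_comp _ _ _ fst (fun h : R => h *: v + x) p);
      [exact: cvg_fst|exact: lc].
have cptK : compact (`[-1, 1]%classic `*` `[0, 1]%classic : set (R * R)).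
  by apply: compact_setX; exact: segment_compact.
have [M [_ HM]] := compact_bounded (continuous_compact (continuous_subspaceT F'lc) cptK).
(* Every number above [M] is a bound; this one is also nonnegative, as domination requires. *)
have M1 : M < `|M| + 1 by rewrite (le_lt_trans (ler_norm _))// ltrDl.
have c01 (g : R -> V -> R) y : continuous (fun p : R * V => g p.1 p.2) ->
   mu.-integrable `[0%R, 1%R] (EFin \o g^~ y).
  by move=> gc; apply: continuous_integrable01; exact: continuous_section1.
have key : h^-1 *: (int01 (F^~ (h *: v + x)) - int01 (F^~ x)) @[h --> 0^']
    --> int01 (F'^~ x).
  have -> : (fun h => h^-1 *: (int01 (F^~ (h *: v + x)) - int01 (F^~ x))) =
      (fun h => h^-1 *: (int01 (f (h + 0)) - int01 (f 0))).
    by apply/funext => h; rewrite addr0 /f scale0r add0r.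
  have -> : int01 (F'^~ x) = \int[mu]_(y in `[0, 1]) partial1of2 f 0 y.
    rewrite /int01; congr (Rintegral _ _ _); apply/funext => s.
    by rewrite partial1of2E derive_val scale0r add0r.
  apply: (@cvg_differentiation_under_integral R _ _ mu f `[0, 1]%classic
    (measurable_itv _) 0 (-1) 1 _ _ _ (fun=> `|M| + 1)).
  - by rewrite /= in_itv/= ltrN10 ltr01.
  - by move=> h _; apply: c01.
  - by move=> h s _ _; have [] := df h s.
  - by move=> s; rewrite addr_ge0.
  - by apply: continuous_integrable01; exact: cst_continuous.
  - move=> h s hI sI; rewrite partial1of2E derive_val.
    apply: (HM _ M1); exists (h, s) => //; split => //=.
    exact: subset_itv_oo_cc hI.
split; last exact/cvg_lim.
by apply/cvg_ex; exists (int01 (F'^~ x)).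
Qed.

Lemma int01_derive (g g' : R -> R) : continuous g' ->
  (forall s : R, is_derive s 1 g (g' s)) -> int01 g' = g 1 - g 0.
Proof.
move=> g'c dg.
have gc : continuous g.
  move=> s; apply: differentiable_continuous; apply/derivable1_diffP.
  by have [] := dg s.
rewrite /int01 /Rintegral (@continuous_FTC2 _ _ g) ?ltr01//.
- exact: continuous_subspaceT.
- split; first by move=> s _; have [] := dg s.
  + exact: cvg_at_right_filter (gc 0).
  + exact: cvg_at_left_filter (gc 1).
- by move=> s _; rewrite derive1E derive_val.
Qed.

End parametric_integral.

(** * Scalar functions of class C^k *)

(** A counterpart of [class_C] with values in [R] itself, where products and integrals are
    available; [class_CP] passes between the two. *)
Fixpoint scalar_C (R : realType) (n k : nat) (u : 'rV[R]_n -> R) : Prop :=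
  continuous u /\
  match k with
  | 0 => True
  | k'.+1 => forall i : 'I_n,
      (forall x, derivable u x (delta_mx 0 i)) /\
      scalar_C k' ('D_(delta_mx 0 i) u)
  end.

Section scalar_C.
Context {R : realType} {n : nat}.
Notation V := 'rV[R]_n.
Notation e i := (delta_mx 0 i : V).
Implicit Types (u w : V -> R) (k : nat).

Lemma scalar_C_continuous k u : scalar_C k u -> continuous u.
Proof. by case: k => [|k] []. Qed.

Lemma scalar_CS k u : scalar_C k.+1 u -> scalar_C k u.
Proof.
elim: k u => [|k IH] u [uc du]; first by split.
by split=> // i; have [dui cui] := du i; split; [exact: dui|exact: IH].
Qed.

Lemma scalar_CW k m u : (k <= m)%N -> scalar_C m u -> scalar_C k u.
Proof.
move=> /subnK <-; elim: (m - k)%N => // p IH.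
by rewrite addSn => /scalar_CS.
Qed.

Lemma scalar_C_cst k (c : R) : scalar_C k (cst c : V -> R).
Proof.
elim: k c => [|k IH] c; split => //; try exact: cst_continuous.
move=> i; split; first by move=> x; exact: derivable_cst.
rewrite (_ : 'D_(e i) (cst c) = cst 0); first exact: IH.
by apply/funext => x; exact: derive_cst.
Qed.

Lemma is_derive_coord (l : 'I_n) (x v : V) :
  is_derive x v (fun y : V => y 0 l) (v 0 l).
Proof.
have dc : derivable (id : V -> V) x v by exact: derivable_id.
split; first by have /derivable_mxP := dc; apply.
by have := derive_mx dc; rewrite derive_id => /rowP/(_ l); rewrite !mxE.
Qed.

Lemma scalar_C_coord k (l : 'I_n) : scalar_C k (fun x : V => x 0 l).
Proof.
case: k => [|k]; split; try exact: coord_continuous; first by [].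
move=> i; split; first by move=> x; have [] := is_derive_coord l x (e i).
rewrite (_ : 'D_(e i) _ = cst (e i 0 l)); first exact: scalar_C_cst.
by apply/funext => x; have [_ ->] := is_derive_coord l x (e i).
Qed.

Lemma scalar_CD k u w : scalar_C k u -> scalar_C k w ->
  scalar_C k (fun x => u x + w x).
Proof.
elim: k u w => [|k IH] u w [uc du] [wc dw]; (split;
  first by move=> x; exact: (cvgD (uc x) (wc x))) => //.
move=> i; have [dui cui] := du i; have [dwi cwi] := dw i; split.
  by move=> x; apply: derivableD; [exact: dui|exact: dwi].
rewrite (_ : 'D_(e i) _ = (fun x => 'D_(e i) u x + 'D_(e i) w x)); first exact: IH.
by apply/funext => x; rewrite -deriveD.
Qed.

Lemma scalar_CM k u w : scalar_C k u -> scalar_C k w ->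
  scalar_C k (fun x => u x * w x).
Proof.
elim: k u w => [|k IH] u w uk wk; move: (uk) (wk) => [uc du] [wc dw]; (split;
  first by move=> x; exact: (cvgM (uc x) (wc x))) => //.
move=> i; have [dui cui] := du i; have [dwi cwi] := dw i; split.
  by move=> x; apply: derivableM; [exact: dui|exact: dwi].
rewrite (_ : 'D_(e i) _ = (fun x => u x * 'D_(e i) w x + w x * 'D_(e i) u x)).
  by apply: scalar_CD; apply: IH => //; exact: scalar_CS.
by apply/funext => x; rewrite -[RHS]deriveM.
Qed.

Lemma scalar_CN k u : scalar_C k u -> scalar_C k (fun x => - u x).
Proof.
move=> uk; rewrite (_ : (fun _ => _) = fun x => cst (-1) x * u x).
  by apply: scalar_CM => //; exact: scalar_C_cst.
by apply/funext => x; rewrite mulN1r.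
Qed.

Lemma scalar_C_sum k m (u : 'I_m -> V -> R) : (forall i, scalar_C k (u i)) ->
  scalar_C k (fun x => \sum_(i < m) u i x).
Proof.
elim: m u => [|m IH] u uk.
  rewrite (_ : (fun _ => _) = cst 0); first exact: scalar_C_cst.
  by apply/funext => x; rewrite big_ord0.
rewrite (_ : (fun _ => _) = fun x => \sum_(i < m) u (widen_ord (leqnSn m) i) x + u ord_max x).
  by apply: scalar_CD => //; exact: IH.
by apply/funext => x; rewrite big_ord_recr.
Qed.

Lemma continuous_rV (W : topologicalType) m (f : W -> 'rV[R]_m) :
  (forall j, continuous (fun x => f x 0 j)) -> continuous f.
Proof.
move=> fc x; apply/cvgrPdist_le => /= eps eps0; near=> y.
rewrite [leLHS]/Num.Def.normr/= mx_normrE (bigmax_le _ (ltW eps0))//= => -[i j] _.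
rewrite !mxE/= (ord1 i).
move: j; near: y; apply: filter_forall => j.
exact: ((cvgrPdist_le _ _).1 (fc j x)).
Unshelve. all: by end_near. Qed.

(** Limits of row vectors are taken coordinate by coordinate, so continuity, derivability and ['D_v]
    all commute with extracting a coordinate; induction on [k] does the rest. *)
Lemma class_CP m k (f : V -> 'rV[R]_m) :
  class_C k f <-> forall j, scalar_C k (fun x => f x 0 j).
Proof.
have cc (g : V -> 'rV[R]_m) j : continuous g -> continuous (fun x => g x 0 j).
  move=> gc x; apply: (@continuous_comp _ _ _ g (fun M : 'rV[R]_m => M 0 j) x).
    exact: gc.
  exact: coord_continuous.
have Dj (g : V -> 'rV[R]_m) i j : (forall x, derivable g x (e i)) ->
    'D_(e i) (fun x => g x 0 j) = (fun x => 'D_(e i) g x 0 j).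
  by move=> dg; apply/funext => x; rewrite derive_mx// mxE.
elim: k f => [|k IH] f.
  split=> [[fc _] j|fc]; first by split=> //; exact: cc.
  by split=> //; apply: continuous_rV => j; have [] := fc j.
split=> [[fc df] j|fk].
  split; first exact: cc.
  move=> i; have [dfi cfi] := df i; split.
    by move=> x; have /derivable_mxP := dfi x; apply.
  by rewrite Dj//; exact: (iffLR (IH _) cfi).
split; first by apply: continuous_rV => j; have [] := fk j.
move=> i.
have dfi x : derivable f x (e i).
  by apply/derivable_mxP => a j; rewrite (ord1 a); have [_ /(_ i)[+ _]] := fk j.
split=> //; apply/IH => j; rewrite -Dj//.
by have [_ /(_ i)[_ +]] := fk j.
Qed.

End scalar_C.

(** * Primitives along one coordinate *)

Section squeeze.
Context {R : realType} {n : nat} (l : 'I_n).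
Notation V := 'rV[R]_n.
Notation e i := (delta_mx 0 i : V).
Implicit Types (u w : V -> R) (k : nat).

(* [x] with its coordinate [l] multiplied by [s] *)
Definition scale_coord (s : R) (x : V) : V := x + ((s - 1) * x 0 l) *: e l.

(** This linearity is the hypothesis that [is_derive_affine] asks of [scale_coord s]. *)
Lemma scale_coordD s h x y :
  scale_coord s (h *: x + y) = h *: scale_coord s x + scale_coord s y.
Proof.
rewrite /scale_coord !mxE mulrDr scalerDl scalerDr scalerA mulrCA -!addrA.
by congr (_ + _); rewrite addrCA.
Qed.

Lemma scale_coord_delta s i :
  scale_coord s (e i) = (if i == l then s else 1) *: e i.
Proof.
rewrite /scale_coord !mxE eqxx/= eq_sym; case: eqP => [->|_].
  by rewrite mulr1 scalerBl scale1r addrC subrK.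
by rewrite mulr0 scale0r addr0 scale1r.
Qed.

Lemma scale_coord1 x : scale_coord 1 x = x.
Proof. by rewrite /scale_coord subrr mul0r scale0r addr0. Qed.

Lemma scale_coord_continuous :
  continuous (fun p : R * V => scale_coord p.1 p.2).
Proof.
move=> p; apply: cvgD; first exact: cvg_snd.
apply: cvgZr_tmp; apply: cvgM.
  by apply: cvgB; [exact: cvg_fst|exact: cvg_cst].
apply: (@continuous_comp _ _ _ snd (fun M : V => M 0 l) p); first exact: cvg_snd.
exact: coord_continuous.
Qed.

(* For [phi = 1], [x 0 l * squeeze phi u x] is the integral of [u] along
   coordinate [l] from [0] to [x 0 l]; other weights [phi] appear when
   differentiating in direction [l]. *)
Definition squeeze (phi : R -> R) u (x : V) : R :=
  int01 (fun s => phi s * u (scale_coord s x)).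

Lemma squeeze_integrand_continuous (phi : R -> R) u :
  continuous phi -> continuous u ->
  continuous (fun p : R * V => phi p.1 * u (scale_coord p.1 p.2)).
Proof.
move=> phic uc p; apply: cvgM.
- have fc : {for p, continuous (fst : R * V -> R)} by exact: cvg_fst.
  exact: (continuous_comp fc (phic p.1)).
- exact: (continuous_comp (scale_coord_continuous (x := p))
    (uc (scale_coord p.1 p.2))).
Qed.

(** Under the integral, the chain rule yields the factor by which [scale_coord s] stretches [e i].
    Absorbing it into the weight makes the derivative a [squeeze] again. *)
Lemma is_derive_squeeze (phi : R -> R) u (i : 'I_n) (x : V) :
  continuous phi -> continuous u -> (forall y, derivable u y (e i)) ->
  continuous ('D_(e i) u) ->
  is_derive x (e i) (squeeze phi u)
    (squeeze (fun s => phi s * (if i == l then s else 1)) ('D_(e i) u) x).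
Proof.
move=> phic uc dui cui.
apply: (@is_derive_int01 R V (fun s x => phi s * u (scale_coord s x))
  (fun s x => phi s * (if i == l then s else 1) * 'D_(e i) u (scale_coord s x))).
- exact: squeeze_integrand_continuous.
- have phic' : continuous (fun s => phi s * (if i == l then s else 1)).
    move=> s; apply: cvgM; first exact: phic.
    by case: ifP => _; [exact: cvg_id|exact: cvg_cst].
  exact: (squeeze_integrand_continuous phic' cui).
- move=> s y.
  have dus : is_derive y (e i) (u \o scale_coord s)
      ((if i == l then s else 1) * 'D_(e i) u (scale_coord s y)).
    apply/is_derive_affine; first by move=> h; exact: scale_coordD.
    by rewrite scale_coord_delta; exact/is_derive_scale/derivableP/dui.
  have := is_deriveM (is_derive_cst (phi s) y (e i)) dus.
  by rewrite scaler0 addr0 -mulrA.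
Qed.

(** The induction on [k] keeps [phi] general because each derivative along [l] multiplies the weight
    by [s]. *)
Lemma scalar_C_squeeze k (phi : R -> R) u : continuous phi ->
  scalar_C k u -> scalar_C k (squeeze phi u).
Proof.
elim: k phi u => [|k IH] phi u phic [uc du]; (split;
  first by apply: int01_continuous; exact: squeeze_integrand_continuous) => //.
move=> i; have [dui cui] := du i.
have D x := is_derive_squeeze x phic uc dui (scalar_C_continuous cui).
split; first by move=> x; have [] := D x.
rewrite (_ : 'D_(e i) _ =
  squeeze (fun s => phi s * (if i == l then s else 1)) ('D_(e i) u)).
  apply: IH => // s; apply: cvgM; first exact: phic.
  by case: ifP => _; [exact: cvg_id|exact: cvg_cst].
by apply/funext => x; have [_ ->] := D x.
Qed.

Definition coord_primitive u (x : V) : R := x 0 l * squeeze (cst 1) u x.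

Lemma scalar_C_coord_primitive k u :
  scalar_C k u -> scalar_C k (coord_primitive u).
Proof.
move=> uk; apply: scalar_CM; first exact: scalar_C_coord.
by apply: scalar_C_squeeze => //; exact: cst_continuous.
Qed.

(** The product rule gives the integral of [x 0 l * (s * 'D_(e l) u (scale_coord s x)) + u
    (scale_coord s x)]. This integrand is the derivative in [s] of [s * u (scale_coord s x)], which
    is [0] at [s = 0] and [u x] at [s = 1]. *)
Lemma derive_coord_primitive u x : scalar_C 1 u ->
  'D_(e l) (coord_primitive u) x = u x.
Proof.
move=> [uc du]; have [dul [cul _]] := du l.
have c1 : continuous (cst 1 : R -> R) by exact: cst_continuous.
have D := is_derive_squeeze x c1 uc dul cul.
have dl : is_derive x (e l) (fun y : V => y 0 l) 1.
  by have := is_derive_coord l x (e l); rewrite mxE !eqxx.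
have [_ ->] := is_deriveM dl D.
rewrite eqxx /squeeze.
have ic (phi : R -> R) (w : V -> R) : continuous phi -> continuous w ->
    continuous (fun s => phi s * w (scale_coord s x)).
  move=> phic wc; exact: (@continuous_section1 R V (fun s x => phi s * w (scale_coord s x))
    (squeeze_integrand_continuous phic wc) x).
have idc : continuous (id : R -> R) by move=> s; exact: cvg_id.
have c2 := ic _ _ idc cul.
have c3 : continuous (fun s : R => x 0 l * (s * 'D_(e l) u (scale_coord s x))).
  by move=> s; apply: cvgM; [exact: cvg_cst|exact: c2].
have c4 : continuous (fun s : R => u (scale_coord s x)).
  by have := ic _ _ c1 uc; under eq_fun do rewrite mul1r.
transitivity (int01 (fun s : R => x 0 l * (s * 'D_(e l) u (scale_coord s x)) + u (scale_coord s x))).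
  rewrite -(int01D c3 c4) -(int01Z _ c2) [X in _ + X]mulr1.
  by congr (_ * int01 _ + int01 _); apply/funext => s /=; rewrite ?mul1r.
have dg (s : R) : is_derive s 1 (fun s : R => s * u (scale_coord s x))
    (x 0 l * (s * 'D_(e l) u (scale_coord s x)) + u (scale_coord s x)).
  have ds : is_derive s 1 (fun s : R => u (scale_coord s x))
      (x 0 l * 'D_(e l) u (scale_coord s x)).
    (* For fixed [x], [scale_coord s x] runs along a line with velocity [x 0 l *: e l]. *)
    apply: (iffRL (@is_derive_affine R R V R u (scale_coord ^~ x) s 1 (x 0 l *: e l) _ _)).
      move=> h; rewrite /scale_coord [h *: 1]mulr1 scalerA addrCA -scalerDl.
      by rewrite -mulrDl addrA.
    exact/is_derive_scale/derivableP/dul.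
  have := is_deriveM (is_derive_id s 1) ds.
  by rewrite [X in _ + X]mulr1 [X in X + _]mulrCA.
rewrite (int01_derive _ dg); first by rewrite mul1r mul0r subr0 scale_coord1.
by move=> s; apply: cvgD; [exact: c3|exact: c4].
Qed.

End squeeze.

(** * Total differentiability of C^1 maps, and the divergence *)

Section total_derivative.
Context {R : realType} {n : nat}.
Notation V := 'rV[R]_n.
Notation e i := (delta_mx 0 i : V).

Lemma coord_le_norm (h : V) j : `|h 0 j| <= `|h|.
Proof.
rewrite [leRHS]/Num.Def.normr/= mx_normrE.
exact: (le_bigmax _ (fun ij => `|h ij.1 ij.2|) (0, j)).
Qed.

Lemma norm_le_coord (v h : V) : (forall j, `|v 0 j| <= `|h 0 j|) -> `|v| <= `|h|.
Proof.
move=> vh; rewrite [leLHS]/Num.Def.normr/= mx_normrE bigmax_le//= => -[i j] _.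
by rewrite (ord1 i)/=; exact: le_trans (vh j) (coord_le_norm h j).
Qed.

(** Go from [x] to [h + x] one coordinate at a time. By the mean value theorem each increment is
    [h 0 i] times a partial derivative at a nearby point, and continuity of the partials makes the
    error small against the norm of [h]. *)
Lemma scalar_C1_differentiable (u : V -> R) x : scalar_C 1 u -> differentiable u x.
Proof.
move=> [uc du].
pose df (h : V) : R := \sum_(i < n) h 0 i * 'D_(e i) u x.
have dfl : linear df.
  move=> c h k; rewrite /df scaler_sumr -big_split; apply: eq_bigr => i _ /=.
  by rewrite !mxE mulrDl -mulrA.
pose dfM := GRing.isLinear.Build _ _ _ _ _ dfl.
pose dfL : {linear V -> R} := HB.pack df dfM.
have dfc : continuous dfL.
  have : scalar_C 0 df.
    apply: scalar_C_sum => i; apply: scalar_CM; first exact: scalar_C_coord.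
    exact: (scalar_C_cst 0 ('D_(e i) u x)).
  by case.
suff o : u \o shift x = cst (u x) + dfL +o_ 0 id.
  by apply/diff_locallyP; rewrite (diff_unique dfc o).
apply/eqaddoP => eps eps0.
(* The divisor [n.+1] stays positive for [n = 0], and [n] such terms still sum to at most [eps]. *)
have eps'0 : 0 < eps / n.+1%:R by rewrite divr_gt0.
have : \forall y \near x, forall i : 'I_n,
    `|'D_(e i) u x - 'D_(e i) u y| <= eps / n.+1%:R.
  apply: (@filter_forall V _ (fun i y =>
    `|'D_(e i) u x - 'D_(e i) u y| <= eps / n.+1%:R) (nbhs x)) => i.
  by have [_ [/(_ x)/cvgrPdist_le/(_ _ eps'0)]] := du i.
move=> /nbhs_ballP[d /= d0 Hd].
have : \forall h \near (0 : V), `|h| < d by apply: nbhs0_lt.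
apply: filterS => h hd.
(* [T k] keeps the first [k] coordinates of [h]: these are the vertices of the path from [0] to
   [h]. *)
pose T k : V := \row_j (if (j < k)%N then h 0 j else 0).
have T0 : T 0%N = 0 by apply/rowP => j; rewrite !mxE.
have Tn : T n = h by apply/rowP => j; rewrite !mxE ltn_ord.
have TS (i : 'I_n) : T i.+1 = h 0 i *: e i + T i.
  apply/rowP => j; rewrite !mxE eqxx/= ltnS leq_eqVlt.
  have [->|ji] := eqVneq j i; first by rewrite eqxx ltnn/= mulr1 addr0.
  by rewrite (negbTE (_ : (j : nat) != i)) ?mulr0 ?add0r.
have -> : (u \o shift x - (cst (u x) + dfL)) h =
    \sum_(i < n) ((u (T i.+1 + x) - u (T i + x)) - h 0 i * 'D_(e i) u x).
  rewrite sumrB -(big_mkord xpredT (fun i => u (T i.+1 + x) - u (T i + x))).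
  rewrite telescope_sumr// T0 Tn add0r.
  by rewrite -[LHS]/(u (h + x) - (u x + df h)) opprD addrA.
apply: (@le_trans _ _ (\sum_(i < n) (eps / n.+1%:R * `|h|))).
  apply: (le_trans (ler_norm_sum _ _ _)); apply: ler_sum => i _.
  have [dui _] := du i.
  rewrite TS -(addrA (h 0 i *: e i)).
  have [c /andP[c0 c1] ->] := @MVT_line R V u (T i + x) (e i) (h 0 i) dui.
  rewrite -mulrBr normrM mulrC; apply: ler_pM => //; last exact: coord_le_norm.
  rewrite distrC; apply: Hd.
  (* The intermediate point differs from [x] by a vector whose coordinates are dominated by those of
     [h], so in the sup norm it stays within [d] of [x]. *)
  rewrite -ball_normE/= addrA opprD addrCA subrr addr0 normrN.
  apply: le_lt_trans hd; apply: norm_le_coord => j; rewrite !mxE eqxx/=.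
  have [->|ji] := eqVneq j i.
    by rewrite ltnn mulr1 addr0 normrM ger0_norm// ler_piMl.
  by rewrite mulr0 add0r; case: ifP => // _; rewrite normr0.
rewrite sumr_const card_ord -[_ *+ n]mulr_natr mulrAC.
apply: ler_wpM2r => //; rewrite -mulrA; apply: ler_piMr; first exact: ltW.
by rewrite mulrC ler_pdivrMr// mul1r ler_nat.
Qed.

Lemma class_C1_differentiable m (f : V -> 'rV[R]_m) x :
  class_C 1 f -> differentiable f x.
Proof.
move=> /class_CP fC.
rewrite (_ : f = \sum_(j < m) (fun y => f y 0 j *: delta_mx 0 j)).
  apply: differentiable_sum => j; apply: differentiableZl.
  exact: scalar_C1_differentiable.
by apply/funext => y; rewrite fct_sumE -row_sum_delta.
Qed.

(** ['J f x] is the matrix of the total differential; differentiability of [f] ties its diagonal to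
    the partial derivatives. *)
Lemma trace_jacobian (f : V -> V) x : class_C 1 f ->
  \tr ('J f x) = \sum_(i < n) 'D_(e i) (fun y => f y 0 i) x.
Proof.
move=> fC; apply: eq_bigr => i _.
have df := class_C1_differentiable x fC.
have := deriveEjacobian (e i) df.
rewrite -rowE derive_mx; last exact: diff_derivable.
by move/rowP/(_ i); rewrite !mxE => <-.
Qed.

End total_derivative.

(** * Fields supported on two coordinates *)

Section two_coordinates.
Context {R : realType} {n : nat}.
Notation V := 'rV[R]_n.
Notation e i := (delta_mx 0 i : V).

(** The indices may coincide, in which case the components add up. This treats the field with
    [i = l] and the remainder along [e l] like all the others. *)
Definition two_coord_field (i l : 'I_n) (a b : V -> R) (x : V) : V :=
  a x *: e i + b x *: e l.

Lemma two_coord_fieldE i l a b j : (fun x => two_coord_field i l a b x 0 j) =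
  (fun x => a x * cst ((j == i)%:R : R) x + b x * cst ((j == l)%:R : R) x).
Proof. by apply/funext => x; rewrite !mxE eqxx. Qed.

Lemma class_C_two_coord_field k i l a b : scalar_C k a -> scalar_C k b ->
  class_C k (two_coord_field i l a b).
Proof.
move=> ak bk; apply/class_CP => j; rewrite two_coord_fieldE.
by apply: scalar_CD; apply: scalar_CM => //; exact: scalar_C_cst.
Qed.

Lemma trace_two_coord_field i l a b x : scalar_C 1 a -> scalar_C 1 b ->
  \tr ('J (two_coord_field i l a b) x) = 'D_(e i) a x + 'D_(e l) b x.
Proof.
move=> a1 b1; rewrite trace_jacobian; last exact: class_C_two_coord_field.
have D (j : 'I_n) : 'D_(e j) (fun y => two_coord_field i l a b y 0 j) x =
    (j == i)%:R * 'D_(e j) a x + (j == l)%:R * 'D_(e j) b x.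
  have [_ /(_ j)[/(_ x)/derivableP da _]] := a1.
  have [_ /(_ j)[/(_ x)/derivableP db _]] := b1.
  have dc (c : R) := is_derive_cst c x (e j).
  rewrite two_coord_fieldE.
  have [_ ->] := is_deriveD (is_deriveM da (dc (j == i)%:R)) (is_deriveM db (dc (j == l)%:R)).
  by rewrite !scaler0 !add0r.
under eq_bigr do rewrite D.
rewrite big_split/= (bigD1 i)//= eqxx mul1r big1 ?addr0; last first.
  by move=> j /negbTE ->; rewrite mul0r.
rewrite (bigD1 l)//= eqxx mul1r big1 ?addr0// => j /negbTE ->.
by rewrite mul0r.
Qed.

(** If [i = l], a second index different from [l] has to be supplied, and [2 <= n] provides one. *)
Lemma two_dimensional_two_coord_field i l a b : (2 <= n)%N ->
  two_dimensional (two_coord_field i l a b).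
Proof.
move=> n2.
have main (i' l' : 'I_n) : i' != l' -> (i == i') || (i == l') -> (l == i') || (l == l') ->
    two_dimensional (two_coord_field i l a b).
  move=> il' hi hl; exists i', l'; split => // k ki kl x.
  rewrite !mxE eqxx/=.
  have -> : (k == i) = false.
    by apply/eqP => E; move: hi; rewrite -E (negbTE ki) (negbTE kl).
  have -> : (k == l) = false.
    by apply/eqP => E; move: hl; rewrite -E (negbTE ki) (negbTE kl).
  by rewrite !mulr0 addr0.
have [il|] := eqVneq i l; last by move=> il; apply: (main i l); rewrite ?eqxx ?orbT.
have [m ml] : exists m : 'I_n, m != l.
  (* The index is 1 if [l] is 0, and 0 otherwise. *)
  exists (if l == 0%N :> nat then Ordinal n2 else Ordinal (ltnW n2)).
  by rewrite -val_eqE /=; case: (nat_of_ord l).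
by apply: (main m l) => //; rewrite ?il ?eqxx ?orbT.
Qed.

End two_coordinates.

(** * The decomposition *)

Theorem proposition7 (R : realType) (n r : nat) (hn : (2 <= n)%N)
    (hr : (1 <= r)%N) (f : 'rV[R]_n -> 'rV[R]_n)
    (fC : class_C r.+1 f) (fcontr : contractive f) :
  exists (N : nat) (g : 'I_N -> 'rV[R]_n -> 'rV[R]_n),
    (forall x, f x = \sum_(k < N) g k x) /\
    (forall k, class_C r (g k) /\ two_dimensional (g k) /\ contractive (g k)).
Proof.
have n0 : (0 < n)%N by exact: ltnW.
pose l := Ordinal n0.
pose a (i : 'I_n) (x : 'rV[R]_n) := f x 0 i.
pose u (i : 'I_n) := 'D_(delta_mx 0 i) (a i).
pose H (i : 'I_n) := coord_primitive l (u i).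
have aSr i : scalar_C r.+1 (a i) by have /class_CP := fC; apply.
have ar i : scalar_C r (a i) by exact: scalar_CS.
have ur i : scalar_C r (u i) by have [_ /(_ i)[]] := aSr i.
have Hr i : scalar_C r (H i) by exact: scalar_C_coord_primitive.
have Nr i : scalar_C r (fun x => - H i x) by exact: scalar_CN.
have sr : scalar_C r (fun x => \sum_(i < n) H i x) by exact: scalar_C_sum.
have zr : scalar_C r (cst 0 : 'rV[R]_n -> R) by exact: scalar_C_cst.
have DH i x : 'D_(delta_mx 0 l) (H i) x = u i x.
  (* [u i] is of class C^r, and [1 <= r] supplies the one derivative used here. *)
  by apply: derive_coord_primitive; exact: (scalar_CW hr).
(* Index 0 carries the remainder along [e l]; the other [n] indices carry the divergence-free
   fields. *)
pose g (k : 'I_n.+1) := if unlift ord0 k is Some i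
  then two_coord_field i l (a i) (fun x => - H i x)
  else two_coord_field l l (cst 0) (fun x => \sum_(i < n) H i x).
exists n.+1, g; split.
  have gS i x : g (lift ord0 i) x = a i x *: delta_mx 0 i - H i x *: delta_mx 0 l.
    by rewrite /g liftK /two_coord_field scaleNr.
  move=> x; rewrite big_ord_recl (eq_bigr _ (fun i _ => gS i x)).
  rewrite /g unlift_none /two_coord_field.
  rewrite sumrB -scaler_suml scale0r add0r addrCA subrr addr0.
  exact: row_sum_delta.
move=> k; rewrite /g; case: (unlift ord0 k) => [i|].
  split; first exact: class_C_two_coord_field.
  split; first exact: two_dimensional_two_coord_field.
  move=> x; rewrite trace_two_coord_field; try exact: (scalar_CW hr).
  have dH : derivable (H i) x (delta_mx 0 l).
    by have [_ /(_ l)[/(_ x)]] := scalar_CW hr (Hr i).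
  by rewrite [X in _ + X](deriveN dH) DH subrr.
split; first exact: class_C_two_coord_field.
split; first exact: two_dimensional_two_coord_field.
move=> x; rewrite trace_two_coord_field; try exact: (scalar_CW hr).
rewrite derive_cst add0r.
have dH i : is_derive x (delta_mx 0 l) (H i) (u i x).
  rewrite -DH; apply/derivableP.
  by have [_ /(_ l)[/(_ x)]] := scalar_CW hr (Hr i).
have -> : (fun x => \sum_(i < n) H i x) = \sum_(i < n) H i.
  by apply/funext => y; rewrite fct_sumE.
have [_ ->] := is_derive_sum dH.
(* The divergence of the remainder has become the sum of the [u i x], which is the trace bounded by
   [fcontr]. *)
have := fcontr x; rewrite trace_jacobian//.
by apply/class_CP => i; exact: scalar_CW (aSr i).
Qed.
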